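(* Let $n\ge 3$ and let $\langle G\mid \mu_n\rangle$ be an $n$-ary group. Then there exist a binary group $\langle G\mid \ast, e\rangle$ on the same set $G$, with identity $e$, and an automorphism $\varphi$ of this binary group such that, writing $e^{\langle k\rangle}$ for the polyadic powers of $e$ in $\langle G\mid\mu_n\rangle$ and $x^{-1}$ for the inverse of $x$ in $\langle G\mid \ast,e\rangle$: (1) for all $g_1,\dots,g_n\in G$, $$\mu_n[g_1,\ldots,g_n]=g_1\ast\varphi(g_2)\ast\varphi^2(g_3)\ast\cdots\ast\varphi^{n-2}(g_{n-1})\ast\varphi^{n-1}(g_n)\ast e^{\langle 1\rangle};$$ (2) the polyadic powers of $e$ are fixed points of $\varphi$: $\varphi(e^{\langle k\rangle})=e^{\langle k\rangle}$ for all $k\in\mathbb{Z}$; (3) the set $H=\{e^{\langle k\rangle}: k\in\mathbb{Z}\}$ is a subgroup of $\langle G\mid \ast,e\rangle$; (4) $\varphi^{n-1}$ is conjugation by the element $e^{\langle 1\rangle}\in H$: for all $g\in G$, $$\varphi^{n-1}(g)=e^{\langle 1\rangle}\ast g\ast\bigl(e^{\langle 1\rangle}\bigr)^{-1}.$$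
   Context: $G$ is a non-empty set. An $n$-ary group $\langle G\mid\mu_n\rangle$ is $G$ with an operation $\mu_n:G^n\to G$ that is totally associative (in the composition of two copies of $\mu_n$ applied to $2n-1$ elements in a fixed order, the inner $\mu_n$ may be placed at any position without changing the value) and such that for every place $i=1,\dots,n$, the equation $\mu_n[u_1,\dots,u_{i-1},h,t_{i+1},\dots,t_n]=g$ has a unique solution $h\in G$ for any given $u_j,t_j,g\in G$. (Such a group is also equipped with the unary queroperation $\bar\mu_1(g)=\bar g$, where the querelement $\bar g$ is the unique solution of $\mu_n[g^{n-1},\bar g]=g$.) In polyads, $g^m$ denotes $m$ consecutive copies of $g$. The iterated product $\boldsymbol{\mu}_n^{\ell}$ is the $\ell$-fold composition of $\mu_n$ with itself, an operation on $\ell(n-1)+1$ arguments (well defined by associativity; for $\ell=0$ it is the identity map). Polyadic powers: for $\ell\ge 0$, $g^{\langle \ell\rangle}=\boldsymbol{\mu}_n^{\ell}[g^{\ell(n-1)+1}]$, so $g^{\langle0\rangle}=g$ and $g^{\langle 1\rangle}=\mu_n[g,\dots,g]$. For $\ell\ge1$ the negative polyadic power $g^{\langle-\ell\rangle}$ is the unique solution of $\boldsymbol{\mu}_n^{\ell}[g^{\ell(n-1)},g^{\langle-\ell\rangle}]=g$. $\varphi^k$ is the $k$-fold composition of $\varphi$. *)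

(* Defs.v *)
From HB Require Import structures.
From mathcomp Require Import all_boot all_order all_algebra.
From mathcomp Require Import boolp classical_sets.
From mathcomp Require Import zify.

Set Implicit Arguments.
Unset Strict Implicit.
Unset Printing Implicit Defensive.

(* An n-ary operation G^n -> G is a function mu : n.-tuple G -> G; arguments
   are numbered from 0. *)

(* The i-th entry of a non-empty polyad (for i out of range, its head). *)
Definition entry (G : Type) (m : nat) (g : m.+1.-tuple G) (i : nat) : G :=
  nth (thead g) g i.

(* mu[g_0, .., g_(i-1), mu[g_i, .., g_(i+n-1)], g_(i+n), .., g_(2n-2)], with
   2n - 1 written as 2 (n - 1) + 1. *)
Definition nested_mul (G : Type) (n : nat) (mu : n.-tuple G -> G)
    (g : (2 * n.-1).+1.-tuple G) (i : nat) : G :=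
  mu [tuple (if j < i then entry g j
             else if j == i :> nat then mu [tuple entry g (i + k) | k < n]
             else entry g (j + n.-1)) | j < n].

Definition totally_associative (G : Type) (n : nat) (mu : n.-tuple G -> G) :
    Prop :=
  forall (g : (2 * n.-1).+1.-tuple G) (i j : 'I_n),
    nested_mul mu g i = nested_mul mu g j.

(* The i-th entry of u is overwritten by the unknown h. *)
Definition uniquely_solvable (G : Type) (n : nat) (mu : n.-tuple G -> G) :
    Prop :=
  forall (i : 'I_n) (u : n.-tuple G) (g : G),
    exists! h : G, mu [tuple (if j == i then h else tnth u j) | j < n] = g.

Definition is_nary_group (G : Type) (n : nat) (mu : n.-tuple G -> G) : Prop :=
  [/\ inhabited G, totally_associative mu & uniquely_solvable mu].

(* The l-fold product of g 0, .., g (l (n - 1)), with the inner products put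
   at the first place; the later values of g are not used. *)
Fixpoint iter_mul_fun (G : Type) (n : nat) (mu : n.-tuple G -> G) (l : nat)
    (g : nat -> G) : G :=
  if l is l'.+1 then
    mu [tuple (if j == 0 :> nat then iter_mul_fun mu l' g
               else g (l' * n.-1 + j)) | j < n]
  else g 0.

Definition iter_mul (G : Type) (n : nat) (mu : n.-tuple G -> G) (l : nat)
    (g : (l * n.-1).+1.-tuple G) : G :=
  iter_mul_fun mu l (entry g).

(* h is a solution of mu^l[g^(l (n - 1)), h] = g. *)
Definition neg_power_eq (G : Type) (n : nat) (mu : n.-tuple G -> G) (g : G)
    (l : nat) (h : G) : Prop :=
  iter_mul mu (l := l) (rcons_tuple (nseq_tuple (l * n.-1) g) h) = g.

(* Negz l is - (l + 1). For an n-ary group with n >= 2 the equation has exactly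
   one solution (neg_power_eq_unique), so the default value g of xget is not
   used; {classic G} is G with a choice operator. *)
Definition polyadic_power (G : Type) (n : nat) (mu : n.-tuple G -> G) (g : G)
    (k : int) : G :=
  match k with
  | Posz l => iter_mul mu (nseq_tuple (l * n.-1).+1 g)
  | Negz l => @xget {classic G} g [set h | neg_power_eq mu g l.+1 h]%classic
  end.

Lemma neg_power_eq_unique (G : Type) (n : nat) (mu : n.-tuple G -> G)
    (g : G) (l : nat) :
  1 < n -> is_nary_group mu -> exists! h, neg_power_eq mu g l.+1 h.
Proof.
case: n mu => // -[//|n] mu _ [_ _ solv].
pose s h := rcons_tuple (nseq_tuple (l.+1 * n.+1) g) h.
have s_val h : tval (s h) = rcons (nseq (l.+1 * n.+1) g) h by [].
have entry_s h k : k < l.+1 * n.+1 -> entry (s h) k = g.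
  by move=> kl; rewrite /entry [X in nth _ X]s_val nth_rcons size_nseq kl nth_nseq kl.
have entry_last h : entry (s h) (l.+1 * n.+1) = h.
  by rewrite /entry [X in nth _ X]s_val nth_rcons size_nseq ltnn eqxx.
have init_eq h h' m : m <= l -> iter_mul_fun mu m (entry (s h)) =
    iter_mul_fun mu m (entry (s h')).
  elim: m => [|m IHm] ml; first by rewrite /= !entry_s.
  congr mu; apply: eq_from_tnth => j; rewrite !tnth_mktuple.
  case: eqP => [_|_]; first exact/IHm/ltnW.
  have jl : m * n.+1 + j < l.+1 * n.+1.
    by have := leq_mul ml (leqnn n.+1); have := ltn_ord j; lia.
  by rewrite !entry_s.
pose u := [tuple (if j == 0 :> nat then iter_mul_fun mu l (entry (s g)) else g)
  | j < n.+2].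
have neg_powerE h : neg_power_eq mu g l.+1 h <->
    mu [tuple (if j == ord_max then h else tnth u j) | j < n.+2] = g.
  suff -> : [tuple (if j == ord_max then h else tnth u j) | j < n.+2] =
      [tuple (if j == 0 :> nat then iter_mul_fun mu l (entry (s h))
              else entry (s h) (l * n.+1 + j)) | j < n.+2] by [].
  apply: eq_from_tnth => j; rewrite !tnth_mktuple.
  case: eqP => [->|/eqP jmax] /=.
    by rewrite -[X in _ = entry _ X]mulSnr entry_last.
  case: eqP => _; first exact: init_eq.
  rewrite entry_s //; move: jmax; rewrite -val_eqE /=.
  by have := ltn_ord j; lia.
have [h [hP hU]] := solv ord_max u g.
by exists h; split=> [|h']; [exact/neg_powerE | move/neg_powerE/hU].
Qed.

(* Main.v *)
(* Words over G of any length ("polyads") are compared by the congruence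
   "interchangeable in every long product"; modulo it they form Post's covering
   group, in which the letter e has an inverse word e' of length n - 2. Setting
   x * y = x e' y and phi x = e x e', the product x_1 * phi x_2 * .. followed by
   * e^<1> telescopes to the word x_1 .. x_n, which gives the first assertion.
   The others follow from it alone. With c = e^<1>, associativity on the polyads
   1^(2 n - 1) and 1^n g 1^(n - 2) gives phi c = c and c * phi g = phi^n g * c,
   so that phi^(n - 1) is conjugation by c; the product formula then shows that
   e^<k> = c^k for every integer k. *)

From HB Require Import structures.
Require Import Defs.
From mathcomp Require Import all_boot all_order all_algebra.
From mathcomp Require Import boolp classical_sets.
From mathcomp Require Import zify.
From Stdlib Require Import Setoid Morphisms.

Local Open Scope group_scope.

(** * Long products of words, with n = N.+1 *)

Section PolyadCalculus.

Variables (G : Type) (N : nat) (mu : N.+1.-tuple G -> G) (x0 : G).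
Hypotheses (N_gt1 : 1 < N) (mu_assoc : totally_associative mu).

(** Words are sequences rather than tuples, so that they can be cut and concatenated without casts
    between lengths; [x0] is read only past the end of a word shorter than N.+1. *)
Definition mul_seq (s : seq G) : G := mu [tuple nth x0 s j | j < N.+1].

Lemma nested_mul_seq (w : (2 * N).+1.-tuple G) (i : nat) : i <= N ->
  nested_mul mu w i =
  mul_seq (take i w ++ mul_seq (take N.+1 (drop i w)) :: drop (i + N.+1) w).
Proof.
move=> iN; have sw : size w = (2 * N).+1 by rewrite size_tuple.
have entryE k : k < (2 * N).+1 -> entry w k = nth x0 w k.
  by move=> kw; apply: set_nth_default; rewrite sw.
congr mu; apply: eq_from_tnth => j; rewrite !tnth_mktuple.
have jN := ltn_ord j.
rewrite nth_cat size_takel ?sw; last by lia.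
case: ltnP => ji; first by rewrite entryE ?nth_take //; lia.
case: eqP => [->|/eqP ji'].
  rewrite subnn; congr mu; apply: eq_from_tnth => k; rewrite !tnth_mktuple.
  by have kN := ltn_ord k; rewrite nth_take // nth_drop entryE //; lia.
have -> : (j - i = (j - i.+1).+1)%N by lia.
by rewrite /= nth_drop entryE; [congr nth; lia | lia].
Qed.

(** Total associativity freed from indices: both sides are nested products of one word of length 2 N
    + 1, with the inner bracket opening after [size a1], respectively [size a2], letters. *)
Lemma mul_seqA (a1 b1 c1 a2 b2 c2 : seq G) :
  size b1 = N.+1 -> size b2 = N.+1 ->
  size (a1 ++ c1) = N -> a1 ++ b1 ++ c1 = a2 ++ b2 ++ c2 ->
  mul_seq (a1 ++ mul_seq b1 :: c1) = mul_seq (a2 ++ mul_seq b2 :: c2).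
Proof.
move=> sb1 sb2 sac1 e12.
have sw : size (a1 ++ b1 ++ c1) == (2 * N).+1.
  by move: sac1; rewrite !size_cat sb1; lia.
have sac2 : size (a2 ++ c2) = N.
  by move/(congr1 size): e12; move: sac1; rewrite !size_cat sb1 sb2; lia.
have nestedE a b c : size b = N.+1 -> size (a ++ c) = N ->
    forall sw : size (a ++ b ++ c) == (2 * N).+1,
    nested_mul mu (Tuple sw) (size a) = mul_seq (a ++ mul_seq b :: c).
  move=> sb; rewrite size_cat => sac sabc; rewrite nested_mul_seq; last by lia.
  rewrite [tval _]/= take_size_cat // drop_size_cat // take_size_cat //.
  by rewrite addnC -drop_drop drop_size_cat // drop_size_cat.
move: (sw); rewrite e12 => sw2.
rewrite -(nestedE _ _ _ sb1 sac1 sw) -(nestedE _ _ _ sb2 sac2 sw2).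
have -> : Tuple sw = Tuple sw2 by apply: val_inj.
have i1 : size a1 < N.+1 by move: sac1; rewrite size_cat; lia.
have i2 : size a2 < N.+1 by move: sac2; rewrite size_cat; lia.
exact: (mu_assoc _ (Ordinal i1) (Ordinal i2)).
Qed.

Fixpoint mul_iter (l : nat) (s : seq G) : G :=
  if l is l'.+1 then mul_iter l' (mul_seq (take N.+1 s) :: drop N.+1 s)
  else head x0 s.

(** If [b] starts after the first N.+1 letters, both sides contract that initial block first and the
    induction hypothesis applies to what is left. The other case comes down to a prefix of length 2
    N + 1. *)
Lemma mul_iter_contract1 (l : nat) (a b c : seq G) :
  size b = N.+1 -> size (a ++ c) = (l * N)%N ->
  mul_iter l.+1 (a ++ b ++ c) = mul_iter l (a ++ mul_seq b :: c).
Proof.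
have mul_iterS k s : mul_iter k.+1 s =
  mul_iter k (mul_seq (take N.+1 s) :: drop N.+1 s) by [].
move=> sb; elim: l a c => [|l IHl] a c sac.
  by case: a c sac => [|//] [|//] _; rewrite /= cats0 take_oversize ?sb.
have [aN|aN] := leqP N.+1 (size a).
  move: sac; rewrite -(cat_take_drop N.+1 a).
  have := size_takel aN; set a1 := take _ a; set a2 := drop _ a => sa1 sac.
  rewrite -!catA !mul_iterS !take_size_cat // !drop_size_cat //.
  rewrite -mul_iterS -!cat_cons IHl //.
  by move: sac; rewrite !size_cat sa1 /= mulSn; lia.
(* Now [b] starts within the first N.+1 letters, so it lies in the prefix [w = a ++ b ++ c1] of
   length 2 N + 1. Each side turns [w] into a single letter, by two bracketings that [mul_seqA]
   identifies. *)
rewrite !mul_iterS.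
have cN : N - size a <= size c by move: sac; rewrite size_cat mulSn; lia.
move: sac; rewrite -(cat_take_drop (N - size a) c).
set c1 := take _ c; set c2 := drop _ c => sac.
have sc1 : size c1 = (N - size a)%N by rewrite size_takel.
have s1 : size (a ++ mul_seq b :: c1) = N.+1 by rewrite size_cat /= sc1; lia.
rewrite -cat_cons (catA a (_ :: _)) (take_size_cat _ s1) (drop_size_cat _ s1).
rewrite (catA b) (catA a).
set w := a ++ b ++ c1.
have sw : size w = (2 * N).+1 by rewrite !size_cat sb sc1; lia.
rewrite takel_cat ?sw; last by lia.
rewrite drop_cat sw ifT; last by lia.
have s2 : size (mul_seq (take N.+1 w) :: drop N.+1 w) = N.+1.
  by rewrite /= size_drop sw; lia.
rewrite -cat_cons (take_size_cat _ s2) (drop_size_cat _ s2).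
congr (mul_iter l (_ :: _)).
apply: (@mul_seqA [::] _ _ a b c1) => //.
- by rewrite size_takel ?sw //; lia.
- by rewrite size_drop sw; lia.
- by rewrite /= cat_take_drop.
Qed.

Lemma mul_iter_contract (l k : nat) (a b c : seq G) :
  size b = (k * N).+1 -> size (a ++ c) = (l * N)%N ->
  mul_iter (k + l) (a ++ b ++ c) = mul_iter l (a ++ mul_iter k b :: c).
Proof.
elim: k b => [|k IHk] b sb sac; first by case: b sb => [|x []].
rewrite -{1}(cat_take_drop N.+1 b) -catA addSn.
have bN : N.+1 <= size b by rewrite sb mulSn; lia.
rewrite mul_iter_contract1 ?size_takel //; last first.
  by move: sac; rewrite !size_cat size_drop sb mulnDl mulSn; lia.
by rewrite -cat_cons IHk //= size_drop sb mulSn; lia.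
Qed.

(* Only meaningful when the size of s is 1 modulo N. *)
Definition polymul (s : seq G) : G := mul_iter (size s %/ N) s.

Lemma polymul1 (x : G) : polymul [:: x] = x.
Proof. by rewrite /polymul divn_small. Qed.

Lemma polymulE (s : seq G) : size s = N.+1 -> polymul s = mul_seq s.
Proof.
move=> ss; rewrite /polymul ss -addn1 divnDl ?dvdnn // divnn divn_small //.
by rewrite (ltnW N_gt1) /= take_oversize ?ss.
Qed.

Lemma polymul_contract (a b c : seq G) :
  size b = 1 %[mod N] -> size (a ++ b ++ c) = 1 %[mod N] ->
  polymul (a ++ b ++ c) = polymul (a ++ polymul b :: c).
Proof.
have modE m : m = 1 %[mod N] -> m = (m %/ N * N).+1.
  by move=> m1; rewrite {1}(divn_eq m N) m1 modn_small ?addn1.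
have divE l : (l * N).+1 %/ N = l.
  by rewrite -addn1 divnMDl ?divn_small ?addn0 //; lia.
move=> /modE sb /modE sabc.
have [l sac] : exists l, size (a ++ c) = (l * N)%N.
  exists (size (a ++ b ++ c) %/ N - size b %/ N)%N.
  by rewrite mulnBl; move: sb sabc; rewrite !size_cat; lia.
set k := (_ %/ _)%N in sb.
rewrite /polymul sb divE.
have -> : size (a ++ b ++ c) = ((k + l) * N).+1.
  by move: sac; rewrite !size_cat sb mulnDl; lia.
have -> : size (a ++ mul_iter k b :: c) = (l * N).+1.
  by rewrite size_cat /= addnS -size_cat sac.
by rewrite !divE mul_iter_contract.
Qed.

(** * The covering congruence on words *)

(* Equality of s and t in the covering group: only contexts that complete them
   to words of size 1 modulo N are relevant. *)
Definition polyad_eq (s t : seq G) : Prop :=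
  size s = size t %[mod N] /\
  forall a b, size (a ++ s ++ b) = 1 %[mod N] ->
    polymul (a ++ s ++ b) = polymul (a ++ t ++ b).

Lemma polyad_eq_size (s t a b : seq G) : size s = size t %[mod N] ->
  size (a ++ s ++ b) = size (a ++ t ++ b) %[mod N].
Proof.
move=> st; rewrite !size_cat; apply/eqP; rewrite eqn_modDl eqn_modDr.
exact/eqP.
Qed.

#[global] Instance polyad_eq_equiv : Equivalence polyad_eq.
Proof.
split=> [s // | s t [st E] | s t u [st E] [tu F]].
  split=> // a b h; rewrite E // -h; exact/polyad_eq_size.
split=> [|a b h]; first by rewrite st.
by rewrite E // F // -h; apply/polyad_eq_size.
Qed.

(** This makes subwords rewritable in place. Rewriting passes through [++] but not through [::],
    which is why words below are spelled [[:: x] ++ s]. *)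
#[global] Instance polyad_eq_cat :
  Proper (polyad_eq ==> polyad_eq ==> polyad_eq) (@cat G).
Proof.
move=> s s' [ss' E] t t' [tt' F]; split.
  by rewrite !size_cat -modnDm ss' tt' modnDm.
move=> a b; rewrite -!catA => h; rewrite E // !(catA a s').
by rewrite F // -h -catA; exact/esym/polyad_eq_size.
Qed.

Lemma polyad_eq_contract (s : seq G) :
  size s = 1 %[mod N] -> polyad_eq [:: polymul s] s.
Proof.
move=> s1; split=> [|a b h]; first by rewrite s1.
rewrite [RHS]polymul_contract // -h; exact/polyad_eq_size.
Qed.

(** The empty context already separates letters. So G embeds in the covering group, and identities
    in G can be proved by manipulating words. *)
Lemma polyad_eq1 (x y : G) : polyad_eq [:: x] [:: y] -> x = y.
Proof. by case=> _ /(_ [::] [::] erefl); rewrite !polymul1. Qed.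

(** * Inverse words and the binary group, from unique solvability *)

Hypothesis mu_solv : uniquely_solvable mu.

Lemma mul_seq_solve (a b : seq G) (y : G) : size (a ++ b) = N ->
  exists! x, mul_seq (a ++ x :: b) = y.
Proof.
rewrite size_cat => sab.
have sx x : size (a ++ x :: b) = N.+1 by rewrite size_cat /=; lia.
have ia : size a < N.+1 by lia.
pose u := [tuple nth x0 (a ++ x0 :: b) j | j < N.+1].
have mulE x : mul_seq (a ++ x :: b) =
    mu [tuple if j == Ordinal ia then x else tnth u j | j < N.+1].
  congr mu; apply: eq_from_tnth => j; rewrite !tnth_mktuple -val_eqE /=.
  rewrite !nth_cat; case: ltngtP => // [ja|->]; last by rewrite subnn.
  by have -> : (j - size a = (j - (size a).+1).+1)%N by lia.
have [x [xy xU]] := mu_solv (Ordinal ia) u y.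
by exists x; split=> [|z]; rewrite mulE //; exact: xU.
Qed.

Lemma polymul_solve (a b : seq G) (y : G) : size (a ++ b) = N ->
  exists x, polyad_eq (a ++ x :: b) [:: y].
Proof.
move=> sab; have [x [xy _]] := mul_seq_solve _ _ y sab.
have sx : size (a ++ x :: b) = N.+1 by move: sab; rewrite !size_cat /=; lia.
exists x; rewrite -xy -polymulE // polyad_eq_contract //.
by rewrite sx -addn1 modnDl.
Qed.

Lemma polymul_cancel (a b : seq G) (x y : G) : size (a ++ b) = N ->
  polyad_eq (a ++ x :: b) (a ++ y :: b) -> x = y.
Proof.
move=> sab [_ /(_ [::] [::])]; rewrite !cats0 /=.
have sx z : size (a ++ z :: b) = N.+1 by move: sab; rewrite !size_cat /=; lia.
rewrite sx !polymulE // -addn1 modnDl => /(_ erefl) xy.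
have [z [_ zU]] := mul_seq_solve a b (mul_seq (a ++ x :: b)) sab.
by rewrite -(zU x) // (zU y).
Qed.

(** A context completing [p] has length 1 modulo N, where N > 1, so it contains a letter next to [p]
    that can absorb it. Absorption from the left is given; absorption from the right follows by
    cancellation. *)
Lemma polyad_eq_nil (p : seq G) : size p = N ->
  (forall x, polyad_eq (x :: p) [:: x]) -> polyad_eq p [::].
Proof.
move=> sp neutr.
have neutl x : polyad_eq (p ++ [:: x]) [:: x].
  pose y := polymul (p ++ [:: x]).
  have pxy : polyad_eq [:: y] (p ++ [:: x]).
    by apply: polyad_eq_contract; rewrite size_cat sp modnDl.
  have sq : size (behead p) = N.-1 by rewrite size_behead sp.
  rewrite -pxy; suff -> : y = x by [].
  (* With p' the tail of [p], x y p' = x p x p' = x x p', since [p] is absorbed by the [x] before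
     it; cancelling around the middle letter gives y = x. *)
  apply: (@polymul_cancel [:: x] (behead p)); first by rewrite /= sq; lia.
  rewrite -[_ ++ _ :: _]/([:: x] ++ [:: y] ++ behead p) pxy.
  by rewrite -catA (catA [:: x]) [[:: x] ++ p]/= neutr.
split=> [|a b]; first by rewrite sp modnn mod0n.
case/lastP: a => [|a x]; last first.
  rewrite -cats1 -!catA; case: (neutr x) => _ /(_ a b) /=; apply.
case: b => [|x b]; first by rewrite cats0 /= sp modnn modn_small.
by case: (neutl x) => _ /(_ [::] b) /=; rewrite -catA; apply.
Qed.

Lemma polyad_inverse (e : G) : exists e' : seq G,
  [/\ size e' = N.-1, polyad_eq ([:: e] ++ e') [::] &
      polyad_eq (e' ++ [:: e]) [::]].
Proof.
have [q] := polymul_solve (nseq N e) [::] e ltac:(by rewrite cats0 size_nseq).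
(* [q] is the querelement of [e]: e^N q = e with N = n - 1. Hence e e e' = e for e' = e^(N - 2)
   q. *)
move=> eq_q; pose e' := nseq (N - 2) e ++ [:: q].
have se' : size e' = N.-1 by rewrite size_cat size_nseq /=; lia.
have e2 : polyad_eq ([:: e; e] ++ e') [:: e].
  by rewrite catA -(nseqD 2) subnKC.
clearbody e'.
(* Every letter equals a word ending in [e], so absorption by an arbitrary [x] need only be checked
   behind [e]. *)
have divr x : exists y, polyad_eq ([:: y] ++ nseq N e) [:: x].
  by have [y] := polymul_solve [::] (nseq N e) x (size_nseq _ _); exists y.
have Nl : nseq N e = nseq N.-1 e ++ [:: e].
  by rewrite -(nseqD _ 1) addn1 prednK // ltnW.
have ee' : polyad_eq ([:: e] ++ e') [::].
  apply: polyad_eq_nil => [|x]; first by rewrite /= se'; lia.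
  have [y yx] := divr x.
  rewrite -[x :: _]/([:: x] ++ [:: e] ++ e') -yx {1}Nl -!catA.
  by rewrite (catA [:: e]) e2 -Nl.
exists e'; split=> //; apply: polyad_eq_nil.
  by rewrite size_cat se' /=; lia.
move=> x; have [y yx] := divr x.
rewrite -[x :: _]/([:: x] ++ e' ++ [:: e]) -yx {1}Nl -!catA.
by rewrite (catA [:: e] e') ee' /= -Nl.
Qed.

(** The product is stated in the nested form x_1 * phi (x_2 * phi (x_3 * ..)), which suits induction
    on the word; [prod_iter_foldr] later spreads it into powers of [phi]. *)
Lemma polyad_coordinates (e : G) :
  exists (mul : G -> G -> G) (inv phi : G -> G),
  [/\ associative mul /\ {morph phi : x y / mul x y},
      left_id e mul /\ right_id e mul,
      left_inverse e inv mul,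
      bijective phi &
      forall g : N.+1.-tuple G, mu g =
        mul (foldr (fun x p => mul x (phi p)) e g) (mu [tuple e | _ < N.+1])].
Proof.
have [e' [se' ee' e'e]] := polyad_inverse e.
have ee'K s : polyad_eq ([:: e] ++ e' ++ s) s by rewrite catA ee'.
have e'eK s : polyad_eq (e' ++ [:: e] ++ s) s by rewrite catA e'e.
have word s : size s = N.+1 -> polyad_eq [:: polymul s] s.
  by move=> ss; apply: polyad_eq_contract; rewrite ss -addn1 modnDl.
pose mul x y := polymul ([:: x] ++ e' ++ [:: y]).
pose phi x := polymul ([:: e] ++ [:: x] ++ e').
pose psi x := polymul (e' ++ [:: x] ++ [:: e]).
have mulE x y : polyad_eq [:: mul x y] ([:: x] ++ e' ++ [:: y]).
  by apply: word; rewrite /= size_cat se' /=; lia.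
have phiE x : polyad_eq [:: phi x] ([:: e] ++ [:: x] ++ e').
  by apply: word; rewrite /= se'; lia.
have psiE x : polyad_eq [:: psi x] (e' ++ [:: x] ++ [:: e]).
  by apply: word; rewrite size_cat se' /=; lia.
have /choice[inv invE] x : exists y, polyad_eq [:: mul y x] [:: e].
  have [|y yx] := polymul_solve [::] (e' ++ [:: x]) e.
    by rewrite /= size_cat se' /=; lia.
  by exists y; rewrite mulE.
exists mul, inv, phi; split.
- split=> [x y z|x y]; apply: polyad_eq1.
    by rewrite !mulE -!catA.
  by rewrite phiE !mulE !phiE -!catA e'eK.
- by split=> x; apply: polyad_eq1; rewrite mulE ?ee'K // e'e.
- by move=> x; apply: polyad_eq1.
- exists psi => x; apply: polyad_eq1.
    by rewrite psiE phiE -!catA e'eK e'e.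
  by rewrite phiE psiE -!catA ee'K ee'.
have mul_e : polyad_eq [:: mu [tuple e | _ < N.+1]] (nseq N.+1 e).
  rewrite -(word (nseq _ _)) ?size_nseq // polymulE ?size_nseq //.
  suff -> : [tuple e | _ < N.+1] = [tuple nth x0 (nseq N.+1 e) j | j < N.+1].
    by [].
  by apply: eq_from_tnth => j; rewrite !tnth_mktuple nth_nseq ltn_ord.
(* Each letter of [s] leaves one trailing e' in the nested product, besides the initial [e]; so the
   product is s followed by the inverse of e^(size s) and then [e]. For size n, multiplying by e^<1>
   appends e' e^n and restores the word. *)
have foldE s : polyad_eq
    ([:: foldr (fun x p => mul x (phi p)) e s] ++ e' ++ nseq (size s) e) s.
  elim: s => [|x s IHs]; first by rewrite cats0.
  rewrite -[nseq (size (x :: s)) e]/([:: e] ++ nseq (size s) e).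
  rewrite -[x :: s]/([:: x] ++ s).
  by rewrite mulE phiE -!catA !e'eK IHs.
move=> g; apply: polyad_eq1; rewrite mulE mul_e -{2}(size_tuple g) foldE.
rewrite -(word g) ?size_tuple // polymulE ?size_tuple //.
suff {1}-> : g = [tuple nth x0 g j | j < N.+1] by [].
by apply: eq_from_tnth => j; rewrite tnth_mktuple -tnth_nth.
Qed.

End PolyadCalculus.

(** * Passage to a bundled binary group *)

(** The existential ranges over structures on G itself, so the carrier of [B] is G by conversion and
    [mu] applies to elements of [B] directly. Decidable equality and choice on G are classical. *)
Lemma group_of_axioms (G : Type) (one : G) (inv : G -> G) (mul : G -> G -> G) :
  associative mul -> left_id one mul -> right_id one mul ->
  left_inverse one inv mul ->
  exists grp : Group.axioms_ G, let B : groupType := Group.Pack grp in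
    (1 : B) = one /\ forall x y : B, x * y = mul x y.
Proof.
move=> mulA mul1 mulr1 mulV.
have mulrV : right_inverse one inv mul.
  move=> x; rewrite -[LHS]mul1 -(mulV (inv x)) -mulA (mulA (inv x)).
  by rewrite mulV mul1 mulV.
pose C : choiceType := HB.pack G (gen_eqMixin G) (gen_choiceMixin G).
pose B : groupType := HB.pack G C
  (isGroup.Build C mulA mul1 mulr1 mulV mulrV).
by exists (Group.class B).
Qed.

Lemma multiplicative1 (B : groupType) (phi : {multiplicative B -> B}) :
  phi 1 = 1.
Proof. by apply: (mulgI (phi 1)); rewrite -gmulfM !mulg1. Qed.

Lemma prod_iter_foldr (B : groupType) (phi : {multiplicative B -> B})
    (n : nat) (g : n.-tuple B) :
  \prod_(i < n) iter i phi (tnth g i) =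
  foldr (fun x p => x * phi p) 1 g.
Proof.
have prodE (s : seq B) :
    \prod_(i < size s) iter i phi (nth 1 s i) =
    foldr (fun x p => x * phi p) 1 s.
  elim: s => [|x s IHs]; first by rewrite big_ord0.
  rewrite big_ord_recl /= -IHs.
  rewrite (big_morph phi (@gmulfM _ _ phi) (multiplicative1 _ phi)).
  by congr (_ * _); apply: eq_bigr.
rewrite -prodE size_tuple; apply: eq_bigr => i _.
by rewrite (tnth_nth 1).
Qed.

(** * Consequences of the product formula, now with n = N.+2 *)

Section HosszuGluskin.

Context {B : groupType} {N : nat} {mu : N.+2.-tuple B -> B}.
Context {phi : {multiplicative B -> B}} {c : B}.
Hypotheses (mu_assoc : totally_associative mu) (phi_bij : bijective phi).
Hypothesis muE :
  forall g, mu g = \prod_(i < N.+2) iter i phi (tnth g i) * c.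

Lemma iter_phi1 (k : nat) : iter k phi 1 = 1.
Proof. by elim: k => // k IHk; rewrite iterS IHk multiplicative1. Qed.

Lemma mu_first2 (g : N.+2.-tuple B) :
  (forall i : 'I_N.+2, 1 < i -> tnth g i = 1) ->
  mu g = tnth g ord0 * phi (tnth g (lift ord0 ord0)) * c.
Proof.
move=> g1; rewrite muE !big_ord_recl big1 => [|i _]; last first.
  by rewrite g1 // iter_phi1.
by rewrite mulg1.
Qed.

Lemma mu_ends (g : N.+2.-tuple B) :
  (forall i : 'I_N.+2, 0 < i < N.+1 -> tnth g i = 1) ->
  mu g = tnth g ord0 * iter N.+1 phi (tnth g ord_max) * c.
Proof.
move=> g1; rewrite muE big_ord_recl big_ord_recr big1 => [|i _]; last first.
  by rewrite g1 ?iter_phi1 //= /bump /= ltnS ltn_ord.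
rewrite [Monoid.Law.sort _ _ _]mul1g; congr (_ * iter _ _ (tnth g _) * _).
exact: val_inj.
Qed.

Lemma mu_ones : mu [tuple 1 | _ < N.+2] = c.
Proof.
rewrite mu_first2 => [|i _]; rewrite !tnth_mktuple //.
by rewrite (multiplicative1 _ phi) !mul1g.
Qed.

(** Bracketing at places 0 and 1 gives c * phi g * c and phi (phi^(n - 1) g * c) * c, and the last c
    cancels. The right side stays unexpanded because phi c = c is itself deduced from the case g =
    1. *)
Lemma phi_twist (g : B) : c * phi g = phi (iter N.+1 phi g * c).
Proof.
(* w is the polyad 1^n g 1^(n - 2), with n = N.+2. *)
pose w := [tuple (if k == N.+2 :> nat then g else 1) | k < (2 * N.+1).+1].
have entryE k : k < (2 * N.+1).+1 ->
    entry w k = if k == N.+2 then g else 1.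
  move=> kw; rewrite /entry (nth_map (Ordinal kw)) ?size_enum_ord //.
  by rewrite nth_enum_ord.
have := mu_assoc w ord0 (lift ord0 ord0); rewrite /nested_mul.
rewrite [LHS]mu_first2 => [|i i1]; last first.
  have iN := ltn_ord i; rewrite tnth_mktuple ltn0 ifF; last by rewrite /=; lia.
  by rewrite entryE ?ifF //=; lia.
rewrite [RHS]mu_first2 => [|i i1]; last first.
  have iN := ltn_ord i; rewrite tnth_mktuple ifF; last first.
    by rewrite /= /bump /=; lia.
  rewrite ifF; last by rewrite /= /bump /=; lia.
  by rewrite entryE ?ifF //=; lia.
move/mulIg; rewrite !tnth_mktuple /bump /= !entryE ?eqxx /=;
  try by rewrite /bump /=; lia.
have -> : [tuple entry w (0 + k) | k < N.+2] = [tuple 1 | _ < N.+2].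
  apply: eq_from_tnth => k; have kN := ltn_ord k.
  by rewrite !tnth_mktuple entryE ?ifF //; lia.
rewrite mu_ones mu_ends => [|k kN]; last first.
  by rewrite tnth_mktuple entryE ?ifF //; rewrite /bump /=; lia.
by rewrite !tnth_mktuple !entryE /bump /= ?eqxx ?mul1g //; lia.
Qed.

Lemma phi_fix : phi c = c.
Proof.
have := phi_twist 1; rewrite iter_phi1 mul1g (multiplicative1 _ phi) mulg1.
exact: esym.
Qed.

(** As [phi] is onto, g = phi h for some h, and the twist relation at h reads c * g = phi^(n - 1) g
    * c. *)
Lemma iter_phi_conj (g : B) : iter N.+1 phi g = c * g * c^-1.
Proof.
have [psi _ psiK] := phi_bij.
rewrite -(psiK g) -iterSr iterS; apply: (mulIg c); rewrite mulgVK.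
by rewrite phi_twist gmulfM phi_fix.
Qed.

Lemma iter_mul_ones (l : nat) (g : nat -> B) :
  (forall k, k <= l * N.+1 -> g k = 1) -> iter_mul_fun mu l g = c ^+ l.
Proof.
elim: l => [|l IHl] g1; first exact: g1.
rewrite /= mu_first2 => [|i i1]; last first.
  rewrite tnth_mktuple ifF ?g1 //; last by lia.
  by have := ltn_ord i; rewrite mulSn; lia.
rewrite !tnth_mktuple /= g1 ?IHl ?(multiplicative1 _ phi) ?mulg1 ?expgSr //.
  by move=> k kl; rewrite g1 // mulSn; lia.
by rewrite /bump /= mulSn; lia.
Qed.

Lemma polyadic_power_nat (l : nat) : polyadic_power mu 1 (Posz l) = c ^+ l.
Proof.
by apply: iter_mul_ones => k kl; rewrite /entry nth_nseq ltnS kl.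
Qed.

(** The outermost product is c^l * phi^(n - 1) h * c, and conjugation by c turns it into c^l * (c *
    h * c^-1) * c = c^(l + 1) * h. *)
Lemma neg_power_eqE (l : nat) (h : B) :
  neg_power_eq mu 1 l.+1 h <-> c ^+ l.+1 * h = 1.
Proof.
rewrite /neg_power_eq /iter_mul; set s := rcons_tuple _ _.
have sE : tval s = rcons (nseq (l.+1 * N.+1) 1) h by [].
have s1 k : k < l.+1 * N.+1 -> entry s k = 1.
  move=> kl; rewrite /entry [X in nth _ X]sE nth_rcons size_nseq kl nth_nseq.
  by rewrite kl.
have sh : entry s (l.+1 * N.+1) = h.
  by rewrite /entry [X in nth _ X]sE nth_rcons size_nseq ltnn eqxx.
rewrite [iter_mul_fun _ _ _]/= mu_ends => [|i iN]; last first.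
  rewrite tnth_mktuple ifF ?s1 //; last by lia.
  by rewrite mulSn; lia.
rewrite !tnth_mktuple /= -mulSnr sh iter_mul_ones => [|k kl]; last first.
  by rewrite s1 // mulSn; lia.
by rewrite -iterS iter_phi_conj !mulgA mulgVK -expgSr.
Qed.

Lemma polyadic_power_neg (l : nat) :
  polyadic_power mu 1 (Negz l) = c ^- l.+1.
Proof.
apply: (@xget_unique {classic Group.sort B}) => [|h /neg_power_eqE ch].
  by apply/neg_power_eqE; rewrite mulgV.
by apply: (mulgI (c ^+ l.+1)); rewrite ch mulgV.
Qed.

(** Integer exponents are handled as differences of naturals, so that closure of H under quotients
    needs no case analysis on signs. *)
Lemma polyadic_power_sub (i j : nat) :
  polyadic_power mu 1 (i%:Z - j%:Z)%R = c ^+ i * c ^- j.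
Proof.
have [ij|ji] := ltnP i j.
  have [k ->] : exists k, j = (i + k.+1)%N by exists (j - i.+1)%N; lia.
  have -> : (i%:Z - (i + k.+1)%:Z)%R = Negz k by lia.
  by rewrite polyadic_power_neg addnC expgnDr invgM mulVKg.
have -> : (i%:Z - j%:Z)%R = Posz (i - j)%N by lia.
by rewrite polyadic_power_nat -{2}(subnK ji) expgnDr mulgK.
Qed.

Lemma polyadic_powerP (k : int) :
  exists i j, polyadic_power mu 1 k = c ^+ i * c ^- j.
Proof.
case: k => l.
  by exists l, 0; rewrite polyadic_power_nat invg1 mulg1.
by exists 0, l.+1; rewrite polyadic_power_neg mul1g.
Qed.

Lemma phi_polyadic_power (k : int) :
  phi (polyadic_power mu 1 k) = polyadic_power mu 1 k.
Proof.
have [i [j ->]] := polyadic_powerP k.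
have phiV x : phi x^-1 = (phi x)^-1.
  by apply: (mulgI (phi x)); rewrite -gmulfM !mulgV (multiplicative1 _ phi).
have phiX l : phi (c ^+ l) = c ^+ l.
  elim: l => [|l IHl]; first exact: multiplicative1.
  by rewrite expgS gmulfM phi_fix IHl.
by rewrite gmulfM phiV !phiX.
Qed.

Lemma polyadic_powers_closed :
  group_closed [pred x : B | `[< exists k, x = polyadic_power mu 1 k >]].
Proof.
split=> [|x y].
  by apply/asboolP; exists (Posz 0); rewrite polyadic_power_nat.
move=> /asboolP[k ->] /asboolP[l ->]; apply/asboolP.
have [i [j ->]] := polyadic_powerP k; have [i' [j' ->]] := polyadic_powerP l.
(* The exponent of the quotient is (i - j) - (i' - j'), regrouped as a difference of naturals. After
   expansion only the commutation of c^-j with c^j' remains. *)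
exists ((i + j')%:Z - (i' + j)%:Z)%R.
rewrite polyadic_power_sub !expgnDr !invgM invgK -!mulgA; congr (_ * _).
rewrite !mulgA; congr (_ * _).
by apply/commute_sym/commuteV/commuteX2/commute_refl.
Qed.

End HosszuGluskin.

Theorem theorem3p2 (G : Type) (n : nat) (mu : n.-tuple G -> G) :
  2 < n -> is_nary_group mu ->
  exists grp : Group.axioms_ G,
  let B : groupType := Group.Pack grp in
  exists phi : {multiplicative B -> B},
  let e : B := 1 in
  let pw : int -> B := polyadic_power mu e in
  [/\ bijective phi,
      forall g : n.-tuple G,
        mu g = \prod_(i < n) iter i phi (tnth g i : B) * pw (Posz 1),
      forall k : int, phi (pw k) = pw k,
      group_closed [pred x : B | `[< exists k : int, x = pw k >]] &
      forall g : B, iter n.-1 phi g = pw (Posz 1) * g * (pw (Posz 1))^-1].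
Proof.
(* The element provided by non-emptiness becomes the identity; its choice is arbitrary. *)
case: n mu => [//|[//|N]] mu N_gt0 [[e] mu_assoc mu_solv].
have [mul [inv [phi [[mulA phiM] [mul1 mulr1] mulV phi_bij muE]]]] :=
  polyad_coordinates _ N.+1 mu e N_gt0 mu_assoc mu_solv e.
have [grp [oneE mulE]] := group_of_axioms _ _ _ _ mulA mul1 mulr1 mulV.
exists grp => B.
have phi_mul : {morph phi : x y / (x : B) * y} by move=> x y; rewrite !mulE.
pose phiB : {multiplicative B -> B} :=
  HB.pack phi (isMultiplicative.Build B B phi phi_mul).
have mu_assocB : @totally_associative B N.+2 mu by [].
have phiB_bij : bijective phiB by [].
exists phiB => e1 pw.
have muB (g : N.+2.-tuple B) : mu g =
    \prod_(i < N.+2) iter i phiB (tnth g i) * (mu [tuple e | _ < N.+2] : B).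
  rewrite prod_iter_foldr mulE muE oneE; congr mul.
  by elim: (tval g) => //= x s ->; rewrite mulE.
have pw1 : pw (Posz 1) = mu [tuple e | _ < N.+2].
  by rewrite /pw (polyadic_power_nat muB).
split=> //.
- by move=> g; rewrite pw1; exact: muB.
- exact: (phi_polyadic_power mu_assocB phiB_bij muB).
- exact: (polyadic_powers_closed mu_assocB phiB_bij muB).
- by move=> g; rewrite pw1; exact: (iter_phi_conj mu_assocB phiB_bij muB).
Qed.
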